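(* Let $b>1$ be an integer and let $N$ be an odd composite number with $\gcd(N,b)=1$. Then $N$ is a Midy pseudoprime to base $b$ if and only if each divisor of $N$ greater than $1$ is either a prime or a Midy pseudoprime to base $b$.
   Context: Let $b>1$ be an integer (the base of numeration). For a positive integer $M$ with $\gcd(M,b)=1$, $|b|_M$ denotes the multiplicative order of $b$ modulo $M$, i.e. the least positive integer $n$ with $b^n\equiv 1 \pmod M$, and $\mathbb{U}_M$ denotes the set of positive integers less than $M$ and relatively prime to $M$. For $x\in\mathbb{U}_M$, the base-$b$ expansion of $x/M$ is purely periodic with period of length $|b|_M$: $\frac{x}{M}=0.\overline{a_1a_2\cdots a_{|b|_M}}$, with $a_i$ base-$b$ digits. Midy's property: let $|b|_M=dk$ with $d,k$ positive integers and $d>1$. Split the period into $d$ blocks of length $k$, let $A_j=[a_{(j-1)k+1}a_{(j-1)k+2}\cdots a_{jk}]_b$ be the integer represented in base $b$ by the $j$-th block, and let $S_d(x)=\sum_{j=1}^d A_j$. One says $M$ has the Midy's property for $b$ and $d$ if $S_d(x)$ is a multiple of $b^k-1$ for all $x\in\mathbb{U}_M$. The set of all such $d$ (divisors $d>1$ of $|b|_M$ for which $M$ has the Midy's property for $b$ and $d$) is denoted $\mathcal{M}_b(M)$. An integer $M$ is a Midy pseudoprime to base $b$ if $M$ is an odd composite number relatively prime to both $b$ and $|b|_M$, and $d\in\mathcal{M}_b(M)$ for every divisor $d>1$ of $|b|_M$. *)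

(* Defs.v *)
From mathcomp Require Import all_boot cyclic.

Set Implicit Arguments.
Unset Strict Implicit.
Unset Printing Implicit Defensive.

(* By Euler's theorem the bounded search below always succeeds when [M > 0]
   is coprime to [b] (see [mulordP]). *)
Definition mulord (b M : nat) : nat :=
  find (fun n => (0 < n) && (b ^ n == 1 %[mod M])) (iota 0 (totient M).+1).

(* The [i]-th base-[b] digit (i >= 1) of [x / M] after the radix point,
   floor (b^i x / M) mod b. *)
Definition digit (b M x i : nat) : nat := (b ^ i * x) %/ M %% b.

(* The integer [a_(m+1) ... a_(m+k)]_b, most significant digit first. *)
Definition digits_val (b M x m k : nat) : nat :=
  \sum_(1 <= i < k.+1) digit b M x (m + i) * b ^ (k - i).

Definition unit_residues (M : nat) : pred nat := fun x => [&& 0 < x, x < M & coprime x M].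

Definition midy_block (b M k x j : nat) : nat := digits_val b M x (j.-1 * k) k.

(* S_d(x), with the period of length |b|_M = d k cut into [d] blocks of length
   k; only meaningful when [d] divides [mulord b M]. *)
Definition midy_sum (b M d x : nat) : nat :=
  \sum_(1 <= j < d.+1) midy_block b M (mulord b M %/ d) x j.

Definition midy_property (b M d : nat) : Prop :=
  forall x, x \in unit_residues M ->
    b ^ (mulord b M %/ d) - 1 %| midy_sum b M d x.

Definition midy_set (b M d : nat) : Prop :=
  [/\ 1 < d, d %| mulord b M & midy_property b M d].

Definition composite (n : nat) : bool := (1 < n) && ~~ prime n.

Definition midy_pseudoprime (b M : nat) : Prop :=
  [/\ odd M, composite M, coprime M b, coprime M (mulord b M)
    & forall d, 1 < d -> d %| mulord b M -> midy_set b M d].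

Lemma mulordP (b M : nat) : 0 < M -> coprime b M ->
  [/\ 0 < mulord b M, b ^ mulord b M = 1 %[mod M]
    & forall n, 0 < n -> b ^ n = 1 %[mod M] -> mulord b M <= n].
Proof.
move=> M0 cbM; rewrite /mulord; set P := (fun n => _); set s := iota _ _.
have hP : has P s.
  apply/hasP; exists (totient M); first by rewrite mem_iota /= add0n ltnS.
  by rewrite /P totient_gt0 M0; apply/eqP/Euler_exp_totient.
have lt : find P s < (totient M).+1 by rewrite -[ltnRHS](size_iota 0) -has_find.
have /andP[p0 /eqP e] : P (find P s).
  by have := nth_find 0 hP; rewrite nth_iota.
split=> // n n0 en; rewrite leqNgt; apply/negP => ltn.
have := before_find 0 ltn; rewrite nth_iota ?(ltn_trans ltn) // add0n.
by rewrite /P n0 en eqxx.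
Qed.

(* The first [k] digits of [x / M] represent floor (b^k x / M). *)
Lemma digits_val0 (b M x k : nat) :
  0 < b -> x < M -> digits_val b M x 0 k = (b ^ k * x) %/ M.
Proof.
move=> b0 xM; rewrite /digits_val; elim: k => [|k IH].
  by rewrite big_geq // mul1n divn_small.
rewrite big_nat_recr //= subnn muln1 add0n /digit.
rewrite (_ : (b ^ k * x) %/ M = (b ^ k.+1 * x) %/ M %/ b) in IH; last first.
  by rewrite -divnMA [M * b]mulnC expnS -mulnA divnMl.
rewrite [RHS](divn_eq _ b) -IH; congr (_ + _).
rewrite big_distrl /=; apply: eq_big_nat => i /andP[_ ik].
by rewrite -mulnA subSn // expnSr.
Qed.

Lemma digits_valE (b M x k : nat) : 0 < b -> x < M -> b ^ k = 1 %[mod M] ->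
  M * digits_val b M x 0 k = (b ^ k - 1) * x.
Proof.
move=> b0 xM e; rewrite digits_val0 // mulnBl mul1n mulnC.
have := divn_eq (b ^ k * x) M; rewrite -[X in _ + X]modnMml e modnMml mul1n.
by rewrite [x %% M]modn_small // => {2}->; rewrite addnK.
Qed.

Lemma digit_periodic (b M x i : nat) : 1 < M -> coprime b M -> 0 < i ->
  digit b M x (i + mulord b M) = digit b M x i.
Proof.
move=> M1 cbM i0; have [_ e _] := mulordP (ltnW M1) cbM.
set n := mulord b M in e *; rewrite /digit.
have b0 : 0 < b ^ n.
  rewrite lt0n; apply/eqP => z; move: e.
  by rewrite z mod0n modn_small.
have /dvdnP[q hq] : M %| b ^ n - 1 by rewrite -eqn_mod_dvd //; apply/eqP.
have -> : b ^ (i + n) * x = b ^ i * (q * x) * M + b ^ i * x.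
  rewrite expnD -[b ^ n](subnK b0) hq mulnDr muln1 mulnDl.
  by congr (_ + _); rewrite -!mulnA [M * x]mulnC.
rewrite divnMDl ?(ltnW M1) // -(prednK i0) expnS -mulnA [b * _]mulnC.
by rewrite {1}[_ * b]mulnC -modnDml modnMr.
Qed.

(* Main.v *)
Require Import Defs.
From mathcomp Require Import all_boot.

(** Write [n] for the order of [b] modulo [M] and [n = d k].  The period of
    [x / M] represents the integer [(b ^ n - 1) x / M], whose digits in base
    [b ^ k] are the blocks; since [b ^ k = 1] modulo [b ^ k - 1], this integer
    is congruent to the sum of its blocks.  Hence the Midy property for [d]
    says that [M (b ^ k - 1)] divides [b ^ n - 1] ([midy_propertyE]), that is,
    that [M] divides [1 + b ^ k + ... + b ^ (k (d - 1))].  In this form the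
    property passes from [M] to its divisors, provided that the order [n] is
    the same for them.

    The order is indeed the same.  Let [p] be a prime factor of a Midy
    pseudoprime [N], and suppose that the order [k] of [b] modulo [p] is a
    proper divisor of [n].  Then [d = n / k > 1], and [p], being a factor of
    [N], divides [1 + b ^ k + ... + b ^ (k (d - 1))], which is congruent to
    [d] modulo [p].  So [p] divides [d] and hence [n], although [N] is coprime
    to [n].  Thus [b] has order [n] modulo every prime factor of [N]
    ([midy_pseudoprime_mulord_prime]), and therefore modulo every divisor
    greater than 1.

    The converse implication is the case of the divisor [N] itself. *)

Lemma mulord_dvd {b M j : nat} : 0 < M -> coprime b M ->
  b ^ j = 1 %[mod M] -> mulord b M %| j.
Proof.
move=> M0 cbM ej; have [n0 en nmin] := mulordP M0 cbM.
rewrite /dvdn -leqn0 leqNgt; apply/negP => r0.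
have : b ^ (j %% mulord b M) = 1 %[mod M].
  rewrite -ej [in RHS](divn_eq j (mulord b M)) expnD [_ * mulord b M]mulnC.
  by rewrite expnM -modnMml -[in RHS]modnXm en modnXm exp1n modnMml mul1n.
by move/(nmin _ r0); rewrite leqNgt ltn_mod n0.
Qed.

Lemma mulord_dvd_dvd {b D M : nat} : 0 < M -> coprime b M -> D %| M ->
  mulord b D %| mulord b M.
Proof.
move=> M0 cbM DM; have [_ en _] := mulordP M0 cbM.
apply: mulord_dvd; [exact: dvdn_gt0 M0 DM | exact: coprime_dvdr DM cbM |].
by rewrite -(modn_dvdm _ DM) en modn_dvdm.
Qed.

Lemma digits_valD (b M x m k l : nat) :
  digits_val b M x m (k + l)
  = digits_val b M x m k * b ^ l + digits_val b M x (m + k) l.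
Proof.
rewrite /digits_val (@big_cat_nat _ _ _ k.+1) ?ltnS ?leq_addr //=.
congr (_ + _).
  rewrite big_distrl /=; apply: eq_big_nat => i /andP[_ ik].
  by rewrite -mulnA -expnD addnBAC.
rewrite -[in LHS](add1n k) big_addn subSn ?leq_addr // addKn.
by apply: eq_big_nat => i _; rewrite -addnA [i + k]addnC subnDl.
Qed.

(** Casting out [b ^ k - 1]: an integer and the sum of its digits in base
    [b ^ k] are congruent. *)
Lemma digits_val_blocks (b M x d k : nat) : 0 < b ->
  digits_val b M x 0 (d * k)
  = \sum_(1 <= j < d.+1) midy_block b M k x j %[mod b ^ k - 1].
Proof.
move=> b0; elim: d => [|d IH]; first by rewrite /digits_val !big_geq.
rewrite big_nat_recr //= mulSnr digits_valD add0n /midy_block /=.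
rewrite -modnDml -[in RHS]modnDml -IH; congr ((_ + _) %% _).
rewrite -{1}(@subnK 1 (b ^ k)) ?expn_gt0 ?b0 // mulnDr muln1.
by rewrite modnMDl.
Qed.

(** The case [x = 1] already gives the divisibility, because the period of
    [1 / M] represents [(b ^ n - 1) / M]; every other period is a multiple of
    that one. *)
Lemma midy_propertyE {b M d : nat} : 1 < b -> 1 < M -> coprime M b ->
    d %| mulord b M ->
  midy_property b M d <->
  M * (b ^ (mulord b M %/ d) - 1) %| b ^ mulord b M - 1.
Proof.
move=> b1 M1 cMb dn; set n := mulord b M; set k := n %/ d.
have b0 := ltnW b1; have M0 := ltnW M1.
have cbM : coprime b M by rewrite coprime_sym.
have [_ en _] := mulordP M0 cbM.
have sumE x : (b ^ k - 1 %| midy_sum b M d x)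
            = (b ^ k - 1 %| digits_val b M x 0 n).
  by rewrite -(divnK dn : k * d = n) mulnC /dvdn digits_val_blocks.
split=> [midy | dvd x /and3P[x0 xM _]].
  have : 1 \in unit_residues M by rewrite unfold_in /= M1 coprime1n.
  move/midy; rewrite sumE => /(dvdn_mul (dvdnn M)).
  by rewrite digits_valE ?muln1.
rewrite sumE -(@dvdn_pmul2l M) // digits_valE //.
exact: dvdn_mulr.
Qed.

Lemma sum_exp_mod {c p : nat} (d : nat) : c = 1 %[mod p] ->
  \sum_(i < d) c ^ i = d %[mod p].
Proof.
move=> c1; elim: d => [|d IH]; first by rewrite big_ord0.
by rewrite big_ord_recr /= -modnDml IH modnDml -modnDmr -modnXm c1 modnXm
  exp1n modnDmr addn1.
Qed.

(** A smaller order [k] modulo [p] would make the geometric sum of [n / k]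
    powers of [b ^ k], a multiple of [N] by the Midy property for [n / k],
    congruent to [n / k] modulo [p]; then [p] would divide both [N] and [n]. *)
Lemma midy_pseudoprime_mulord_prime {b N p : nat} : 1 < b ->
  midy_pseudoprime b N -> prime p -> p %| N -> mulord b p = mulord b N.
Proof.
move=> b1 [_ /andP[N1 _] cNb cNn midyN] pp pN.
have N0 := ltnW N1; have p0 := prime_gt0 pp.
have cbN : coprime b N by rewrite coprime_sym.
have [n0 _ _] := mulordP N0 cbN.
have [k0 ek _] := mulordP p0 (coprime_dvdr pN cbN).
have kn := mulord_dvd_dvd N0 cbN pN.
set k := mulord b p in k0 ek kn *; set n := mulord b N in n0 kn cNn midyN *.
have nE := divnK kn; set d := n %/ k in nE.
have d0 : 0 < d by rewrite divn_gt0 // dvdn_leq.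
have dn : d %| n by rewrite -nE dvdn_mulr.
case: (ltngtP d 1) => [|d1|dE]; [by rewrite ltnNge d0 | | by rewrite -nE dE mul1n].
have [_ _ /(midy_propertyE b1 N1 cNb dn)] := midyN d d1 dn.
rewrite -/n -{1}nE mulKn // -nE mulnC [d * k]mulnC expnM.
have bk1 : 0 < b ^ k - 1 by rewrite subn_gt0 -[1](exp1n k) ltn_exp2r.
rewrite [X in _ %| X]subn1 predn_exp -subn1 dvdn_pmul2l // => Nsum.
have pd : p %| d by rewrite /dvdn -(sum_exp_mod d ek); apply: dvdn_trans Nsum.
have := coprime_dvdl pN (coprime_dvdr (dvdn_trans pd dn) cNn).
by rewrite /coprime gcdnn => /eqP p1; rewrite p1 in pp.
Qed.

(** Modulo [D] the order is squeezed, for divisibility, between the orders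
    modulo [N] and modulo a prime factor of [D], which coincide. *)
Lemma midy_pseudoprime_mulord_dvd {b N D : nat} : 1 < b ->
  midy_pseudoprime b N -> D %| N -> 1 < D -> mulord b D = mulord b N.
Proof.
move=> b1 psN DN D1; have [_ /andP[N1 _] cNb _ _] := psN.
have cbN : coprime b N by rewrite coprime_sym.
apply/eqP; rewrite eqn_dvd (mulord_dvd_dvd (ltnW N1) cbN DN) /=.
rewrite -(midy_pseudoprime_mulord_prime b1 psN (pdiv_prime D1)).
  exact: mulord_dvd_dvd (ltnW D1) (coprime_dvdr DN cbN) (pdiv_dvd D).
exact: dvdn_trans (pdiv_dvd D) DN.
Qed.

Theorem corollary11 (b N : nat) (hb : 1 < b) (N_odd : odd N)
    (N_comp : composite N) (N_cop : coprime N b) :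
  midy_pseudoprime b N <->
  (forall D : nat, D %| N -> 1 < D -> prime D \/ midy_pseudoprime b D).
Proof.
split=> [psN D DN D1 | divs]; last first.
  have /andP[N1 Nnp] := N_comp.
  by case: (divs N (dvdnn N) N1) => // Np; rewrite Np in Nnp.
case: (boolP (prime D)) => [|Dnp]; [by left | right].
have ordE := midy_pseudoprime_mulord_dvd hb psN DN D1.
have [_ /andP[N1 _] cNb cNn midyN] := psN.
have cDb := coprime_dvdl DN cNb.
split=> //; [exact: dvdn_odd N_odd | by rewrite /composite D1 | |].
  by rewrite ordE (coprime_dvdl DN).
move=> d d1 dn; split=> //; apply/(midy_propertyE hb D1 cDb dn).
rewrite ordE in dn *; have [_ _ /(midy_propertyE hb N1 cNb dn)] := midyN d d1 dn.
by apply: dvdn_trans; apply: dvdn_mul.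
Qed.
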